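(* Let $(X,\|\cdot\|)$ be a normed space, let $b\in[0,\infty)$, $a\in[0,1)$, $\alpha\in(0,1)$, and let $T:X\to X$ be an $(a,b,\alpha)$-enriched interpolative Kannan type operator. Put $\lambda=\frac{1}{b+1}$ and $T_\lambda=(1-\lambda)I+\lambda T$. Then there is a point $x^*\in X$ such that: (1) $\mathrm{Fix}(T)=\{x^*\}$; (2) for every $x_0\in X$ such that the $T_\lambda$-orbital set $O(T_\lambda,x_0)$ is a complete subset of $X$, the $T_\lambda$-orbital sequence $\{x_n\}_{n=0}^\infty$ around $x_0$, given by $x_{n+1}=(1-\lambda)x_n+\lambda Tx_n$ for $n\ge 0$, converges to $x^*$.
   Context: For a map $T:X\to X$, $\mathrm{Fix}(T)=\{x\in X: Tx=x\}$, and $I$ is the identity map. A map $T:X\to X$ on a normed space $(X,\|\cdot\|)$ is called an $(a,b,\alpha)$-enriched interpolative Kannan type operator, where $b\in[0,\infty)$, $a\in[0,1)$ and $\alpha\in(0,1)$, if for all $x,y\in X$ $$\|b(x-y)+(Tx-Ty)\|\le a\,\|x-Tx\|^{\alpha}\,\|y-Ty\|^{1-\alpha}.$$ For a map $S:X\to X$ and $x_0\in X$, the $S$-orbital sequence around $x_0$ is $x_n=S^n x_0$, $n\ge 0$, and $O(S,x_0)=\{S^n x_0: n\ge 0\}$ is the $S$-orbital set. *)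

(* Defs.v *)
From mathcomp Require Import all_boot all_order all_algebra.
From mathcomp Require Import all_classical all_reals all_analysis.
Import Order.TTheory GRing.Theory Num.Theory.
Import numFieldNormedType.Exports.

Set Implicit Arguments.
Unset Strict Implicit.
Unset Printing Implicit Defensive.

Local Open Scope classical_set_scope.
Local Open Scope ring_scope.

Definition fixset_of (X : Type) (T : X -> X) : set X := [set x | T x = x].

Definition orbital_seq (X : Type) (S : X -> X) (x0 : X) : nat -> X :=
  fun n => iter n S x0.

Definition orbital_set (X : Type) (S : X -> X) (x0 : X) : set X :=
  range (orbital_seq S x0).

(* Sequential completeness of a subset, which for subsets of a (pseudo)metric
   space is completeness for the induced metric; the library only has
   completeness of whole spaces. *)
Definition complete_subset (X : uniformType) (A : set X) : Prop :=
  forall u : nat -> X, (forall n, A (u n)) -> cauchy (u @ \oo) ->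
    exists2 l, A l & u @ \oo --> l.

Definition averaged (R : realType) (X : normedModType R) (lambda : R)
  (T : X -> X) : X -> X := fun x => (1 - lambda) *: x + lambda *: T x.

(* As 0 `^ p = 0 for p != 0, the right-hand side vanishes when x or y is a
   fixed point of T. *)
Definition enriched_interpolative_kannan (R : realType) (X : normedModType R)
  (a b alpha : R) (T : X -> X) : Prop :=
  [/\ 0 <= b, 0 <= a < 1, 0 < alpha < 1 &
    forall x y : X,
      `|b *: (x - y) + (T x - T y)|
        <= a * `|x - T x| `^ alpha * `|y - T y| `^ (1 - alpha)].

(* Main.v *)
(** Since [T - I] is [b + 1] times [Tl - I], the averaged map [S := Tl] satisfies
    [|S x - S y| <= a |x - S x|^alpha |y - S y|^(1 - alpha)]. With [y := S x] this
    gives [|S^n x - S^(n+1) x|^alpha <= a^n |x - S x|^alpha]; applied to [S^n x]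
    and any [z], it then shows that [S (S^n x)] converges to [S z]. Limits being
    unique, [S] is constant: its value is the fixed point, and its orbits are
    stationary from rank 1 on. *)
Require Import Defs.
From mathcomp Require Import all_boot all_order all_algebra.
From mathcomp Require Import all_classical all_reals all_analysis.
Import Order.TTheory GRing.Theory Num.Theory.
Import numFieldNormedType.Exports.
Local Open Scope classical_set_scope.
Local Open Scope ring_scope.

Lemma le0_geometric_bound (R : realType) (a r K : R) :
  0 <= a < 1 -> (forall n, r <= a ^+ n * K) -> r <= 0.
Proof.
move=> /andP[a0 a1] h.
have cv : (fun n => a ^+ n * K) @ \oo --> 0 * K.
  by apply: cvgM (cvg_cst K); apply: cvg_expr; rewrite ger0_norm.
rewrite mul0r in cv; rewrite -(cvg_lim _ cv)//.
apply: limr_ge; first by apply/cvg_ex; exists 0.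
by apply: nearW.
Qed.

(** For [v > 0], write [v] as [v^alpha * v^(1 - alpha)] and cancel the second factor. For [v = 0]
    the left side is 0 because [alpha != 0]; with exponent 0 it would be 1. *)
Lemma powR_le_of_interpolation (R : realType) (a alpha u v : R) :
  0 <= a -> alpha != 0 -> 0 <= v ->
  v <= a * u `^ alpha * v `^ (1 - alpha) -> v `^ alpha <= a * u `^ alpha.
Proof.
move=> a0 al0; rewrite le_eqVlt => /predU1P[<- _|v0 h].
  by rewrite powR0// mulr_ge0// powR_ge0.
rewrite -(ler_pM2r (powR_gt0 (1 - alpha) v0)) -powRD.
  by rewrite addrC subrK powRr1// ltW.
by apply/implyP => _; rewrite gt_eqF.
Qed.

Section InterpolativeKannan.
Variables (R : realType) (X : normedModType R) (a alpha : R) (S : X -> X).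
Hypotheses (a01 : 0 <= a < 1) (alpha01 : 0 < alpha < 1).
Hypothesis kannanS : forall x y : X,
  `|S x - S y| <= a * `|x - S x| `^ alpha * `|y - S y| `^ (1 - alpha).

Lemma interpolative_kannan_displacement (x : X) (n : nat) :
  `|iter n S x - S (iter n S x)| `^ alpha <= a ^+ n * `|x - S x| `^ alpha.
Proof.
have [/andP[a0 _] /andP[al0 _]] := (a01, alpha01).
elim: n => [|n IHn]; first by rewrite mul1r.
rewrite exprS -mulrA; apply: le_trans (ler_wpM2l a0 IHn).
(* [kannanS] is taken at [iter n S x] and its image, so the displacement of the image is also the
   distance being bounded: it stands on both sides. *)
by apply: powR_le_of_interpolation; rewrite ?gt_eqF//; exact: kannanS.
Qed.

Lemma interpolative_kannan_constant (x y : X) : S x = S y.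
Proof.
have /andP[a0 _] := a01.
have orbit z n : `|S (iter n S x) - S z| <=
    a ^+ n * (a * `|x - S x| `^ alpha * `|z - S z| `^ (1 - alpha)).
  apply: le_trans (kannanS _ _) _.
  rewrite !mulrA ler_wpM2r ?powR_ge0// [a ^+ n * a]mulrC -mulrA.
  by rewrite ler_wpM2l// interpolative_kannan_displacement.
apply/eqP; rewrite -subr_eq0 -normr_le0.
apply: le0_geometric_bound a01 _ => n.
(* The orbit of [x] is compared with [z = y] and with [z = x]; the triangle inequality then bounds
   the fixed distance by [a ^+ n] times a constant, for every [n]. *)
have -> : S x - S y = (S (iter n S x) - S y) - (S (iter n S x) - S x).
  by rewrite opprB [RHS]addrC addrA subrK.
apply: le_trans (ler_normB _ _) _.
by apply: le_trans (lerD (orbit y n) (orbit x n)) _; rewrite -mulrDr.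
Qed.

End InterpolativeKannan.

Section Averaged.
Variables (R : realType) (X : normedModType R) (b : R) (T : X -> X).
Hypothesis b0 : 0 <= b.
Let S := averaged (1 / (b + 1)) T.

Lemma scale_averaged (x : X) : (b + 1) *: S x = b *: x + T x.
Proof.
have b1 : b + 1 != 0 by rewrite gt_eqF// ltr_wpDl.
rewrite /S /averaged scalerDr !scalerA mulrBr mulr1 mulrCA divff// mulr1.
by rewrite addrK scale1r.
Qed.

Lemma fixed_averaged (x : X) : (T x = x) <-> (S x = x).
Proof.
have b1 : b + 1 != 0 by rewrite gt_eqF// ltr_wpDl.
have xE : (b + 1) *: x = b *: x + x by rewrite scalerDl scale1r.
split=> [Tx|Sx].
  by apply: (scalerI b1); rewrite scale_averaged Tx xE.
by apply: (addrI (b *: x)); rewrite -scale_averaged Sx xE.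
Qed.

(** Displacements of [T] are [b + 1] times those of [S], and the exponents [alpha] and [1 - alpha]
    add up to 1, so the same factor [b + 1] comes out of both sides. *)
Lemma enriched_kannan_averaged (a alpha : R) :
  enriched_interpolative_kannan a b alpha T -> forall x y : X,
  `|S x - S y| <= a * `|x - S x| `^ alpha * `|y - S y| `^ (1 - alpha).
Proof.
move=> [_ _ _ hT] x y.
have b1 : 0 < b + 1 by rewrite ltr_wpDl.
have dE z : `|z - T z| = (b + 1) * `|z - S z|.
  rewrite -[b + 1 in RHS]gtr0_norm// -normrZ scalerBr scale_averaged.
  by rewrite scalerDl scale1r opprD addrACA subrr add0r.
rewrite -(ler_pM2l b1) -{1}[b + 1]gtr0_norm// -normrZ scalerBr !scale_averaged.
rewrite opprD addrACA -scalerBr; apply: le_trans (hT x y) _.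
rewrite !dE !powRM ?(ltW b1)//.
have bE : (b + 1) `^ alpha * (b + 1) `^ (1 - alpha) = b + 1.
  rewrite -powRD; last by apply/implyP => _; rewrite gt_eqF.
  by rewrite [alpha + _]addrC subrK powRr1// ltW.
by rewrite -[X in _ <= X * _]bE [a * (_ * _)]mulrCA mulrACA.
Qed.

End Averaged.

Theorem theorem2p0p2 (R : realType) (X : normedModType R) (a b alpha : R)
    (T : X -> X)
    (hT : enriched_interpolative_kannan a b alpha T) :
  let lambda := 1 / (b + 1) in
  let Tl := averaged lambda T in
  exists xs : X,
    fixset_of T = [set xs] /\
    (forall x0 : X, complete_subset (orbital_set Tl x0) ->
       orbital_seq Tl x0 @ \oo --> xs).
Proof.
move=> lambda Tl; have [b0 a01 al01 _] := hT.
have Tl_const x y : Tl x = Tl y.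
  apply: (@interpolative_kannan_constant _ _ a alpha) => //.
  exact: enriched_kannan_averaged.
(* [0] is an arbitrary choice: [Tl] takes one value only, which it therefore fixes. *)
exists (Tl 0); split.
  apply/seteqP; split=> x /=.
    by move/(fixed_averaged _ _ _ T b0) => <-; exact: Tl_const.
  by move=> ->; apply/(fixed_averaged _ _ _ T b0); exact: Tl_const.
(* The term of rank 0 is [x0] itself, which may differ from [Tl 0]; the shift drops it. *)
move=> x0 _; rewrite -cvg_shiftS.
have -> : [sequence orbital_seq Tl x0 n.+1]_n = fun=> Tl 0.
  by apply/funext => n; exact: Tl_const.
exact: cvg_cst.
Qed.
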